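(* Let $\mathbb K$ be a field of characteristic zero. For integers $2\le j<q$ and $r\ge0$ put $$\begin{aligned} F_{j,q,r}={}&\sum_{t=0}^r\ \sum_{l=j}^{\left[\frac{j+q-1}{2}\right]}\ \sum_{m=q+1}^{q+\left[\frac{j+t}{2}\right]}(-1)^{l-j+m-q}\binom{q-l-1}{l-j}\binom{j+q-m+t-1}{m-q-1}x_{l,t}\,x_{m,r-t}\\ &+\sum_{t=0}^r\ \sum_{l=j}^{\left[\frac{j+q}{2}\right]}\ \sum_{m=q}^{q+\left[\frac{j+t}{2}\right]}(-1)^{l-j+m-q}\binom{q-l}{l-j}\binom{j+q-m+t}{m-q}x_{l,t}\,x_{m,r-t}\\ &+\sum_{t=0}^r\ \sum_{m=j}^{q+\left[\frac{j+t}{2}\right]}(-1)^{m-j+1}\binom{2q-m+t}{m-j}x_{q,t}\,x_{m,r-t}, \end{aligned}$$ and for $2\le j<q$, $r\ge -1$ put $$G_{j,q,r}=\sum_{l=j}^{\left[\frac{j+q-1}{2}\right]}(-1)^l\binom{q-l-1}{l-j}x_{l,r+1}+\sum_{l=j}^{\left[\frac{j+q}{2}\right]}(-1)^l\binom{q-l}{l-j}x_{l,r+1}-(-1)^q x_{q,r+1}.$$ 1) Let $n=2k+1\ge 9$ and consider a linear combination $$\Psi=\sum_{s=0}^{n-5}\sum_{j=2}^{\left[\frac{n-1}{2}\right]}x_{j,s}\Psi_{j,s}$$ of the basic cocycles $\Psi_{j,s}$ from $\oplus_{s=0}^{n-5}H^2_s(\mathfrak m_0(n),\mathfrak m_0(n))$.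 Then the cocycle $\Psi$ satisfies the deformation equation if and only if its coordinates $x_{j,s}$ satisfy the finite system of quadratic equations $$F_{j,q,r}=0,\qquad 2\le j<q,\quad 9\le j+2q+1+r\le n,\quad r\ge 0.$$ 2) Let $n=2k\ge 10$, let $x\in\{0,1\}$, and consider a linear combination $$\Psi=\sum_{s=0}^{n-5}\sum_{j=2}^{\left[\frac{n-1}{2}\right]}x_{j,s}\Psi_{j,s}$$ of the basic cocycles of $\mathfrak m_0(2k)$. Then the cocycle $x\Psi_{k,-1}+\Psi$ satisfies the deformation equation if and only if the coordinates $x_{j,s}$ satisfy the system $$\left\{\begin{array}{ll} F_{j,q,r}=0, & 2\le j<q,\ 9\le j+2q+1+r<2k,\ r\ge 0,\\ F_{j,q,r}+(-1)^{k-j-q}\,x\,G_{j,q,r}=0, & 2\le j<q,\ j+2q+1+r=2k,\ r\ge 0,\\ x\,G_{j,q,-1}=0, & 2\le j<q,\ j+2q=2k. \end{array}\right.$$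
   Context: $\mathfrak m_0(n)$ is the $n$-dimensional Lie algebra over $\mathbb K$ with basis $e_1,\dots,e_n$ and nonzero brackets $[e_1,e_i]=e_{i+1}$, $2\le i\le n-1$. It is graded by giving $e_i$ degree $i$; a cochain with values in $\mathfrak m_0(n)$ (adjoint representation) has degree $s$ if it sends $(e_{i_1},\dots,e_{i_q})$ to a multiple of $e_{i_1+\dots+i_q+s}$, and $H^2_s(\mathfrak m_0(n),\mathfrak m_0(n))$ is the degree $s$ part of the second cohomology with adjoint coefficients. Let $e^1,\dots,e^n$ be the dual basis, with $(e^a\wedge e^b)(e_a,e_b)=1$. For $j\ge2$, $s\ge0$, $2j+1+s\le n$, the basic cocycle $\Psi_{j,s}$ is $$\Psi_{j,s}=\sum_{i=0}^{n-2j-1-s}e_{2j+1+s+i}\otimes\Big(\sum_{l=0}^{j-2}(-1)^l\binom{i+l}{l}e^{j-l}\wedge e^{j+1+l+i}\Big).$$ These cocycles form a basis of $\oplus_{s=0}^{n-5}H^2_s(\mathfrak m_0(n),\mathfrak m_0(n))$; for pairs $(j,s)$ with $2j+1+s>n$ the sum is empty and $\Psi_{j,s}=0$. For $n=2k$, $$\Psi_{k,-1}=e_{2k}\otimes\sum_{l=0}^{k-2}(-1)^l e^{k-l}\wedge e^{k+1+l},$$ which is a 2-cocycle of degree $-1$. A skew-symmetric bilinear map $\Phi$ on $\mathfrak m_0(n)$ satisfies the deformation equation if the bracket $[\cdot,\cdot]_{\mathfrak m_0(n)}+\Phi$ satisfies the Jacobi identity; for a cocycle $\Phi$ this is the equation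 $[\Phi,\Phi]=0$, where $\tfrac12[\Phi,\Phi](u,v,w)=\Phi(\Phi(u,v),w)+\Phi(\Phi(v,w),u)+\Phi(\Phi(w,u),v)$ (Nijenhuis–Richardson bracket). $[a]$ for a rational number $a$ (in summation limits) denotes the integer part; empty sums are zero. *)

(* Defs.v *)
From mathcomp Require Import all_boot all_order all_algebra.
Set Implicit Arguments.
Unset Strict Implicit.
Unset Printing Implicit Defensive.
Import GRing.Theory.
Local Open Scope ring_scope.

Section M0.

Variables (K : fieldType) (n : nat).

(* m_0(n) has underlying space 'rV[K]_n.  Basis vectors carry their
   mathematical index 1 <= i <= n, so that e_i is the row vector supported at
   the ordinal i.-1; outside that range basis_e and dual_e are zero. *)
Definition basis_e (i : nat) : 'rV[K]_n := \row_(a < n) (a.+1 == i)%:R.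

Definition dual_e (i : nat) (u : 'rV[K]_n) : K := \sum_(a < n | a.+1 == i) u 0 a.

Definition wedge (a b : nat) (u v : 'rV[K]_n) : K :=
  dual_e a u * dual_e b v - dual_e a v * dual_e b u.

Definition cochain2 := 'rV[K]_n -> 'rV[K]_n -> 'rV[K]_n.

(* Bilinear skew-symmetric extension of [e_1, e_i] = e_(i+1), 2 <= i <= n-1. *)
Definition m0_bracket : cochain2 := fun u v =>
  \sum_(2 <= i < n) wedge 1 i u v *: basis_e i.+1.

Definition jacobi (B : cochain2) : Prop :=
  forall u v w, B (B u v) w + B (B v w) u + B (B w u) v = 0.

Definition deformation_equation (Phi : cochain2) : Prop :=
  jacobi (fun u v => m0_bracket u v + Phi u v).

(* For 2j+1+s > n the truncated bound n - (2j+s) is 0 and the sum is empty. *)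
Definition Psi_basic (j s : nat) : cochain2 := fun u v =>
  \sum_(i < n - (2 * j + s))
    (\sum_(l < j - 1)
       (-1) ^+ l * 'C(i + l, l)%:R * wedge (j - l) (j + 1 + l + i) u v)
      *: basis_e (2 * j + 1 + s + i).

(* Psi_{k,-1}, meaningful when n = 2k. *)
Definition Psi_minus1 (k : nat) : cochain2 := fun u v =>
  (\sum_(l < k - 1) (-1) ^+ l * wedge (k - l) (k + 1 + l) u v)
    *: basis_e (2 * k).

Definition Psi_comb (x : nat -> nat -> K) : cochain2 := fun u v =>
  \sum_(0 <= s < (n - 5).+1) \sum_(2 <= j < ((n - 1)./2).+1)
    x j s *: Psi_basic j s u v.

End M0.

(* For 2 <= j < q none of the natural-number subtractions below is truncated
   within the summation ranges. *)
Definition F_poly (K : fieldType) (x : nat -> nat -> K) (j q r : nat) : K :=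
  \sum_(0 <= t < r.+1)
    \sum_(j <= l < ((j + q - 1)./2).+1)
      \sum_(q + 1 <= m < (q + (j + t)./2).+1)
        (-1) ^+ ((l - j) + (m - q))
        * 'C(q - l - 1, l - j)%:R * 'C(j + q + t - m - 1, m - q - 1)%:R
        * x l t * x m (r - t)%N
  + \sum_(0 <= t < r.+1)
    \sum_(j <= l < ((j + q)./2).+1)
      \sum_(q <= m < (q + (j + t)./2).+1)
        (-1) ^+ ((l - j) + (m - q))
        * 'C(q - l, l - j)%:R * 'C(j + q + t - m, m - q)%:R
        * x l t * x m (r - t)%N
  + \sum_(0 <= t < r.+1)
    \sum_(j <= m < (q + (j + t)./2).+1)
      (-1) ^+ (m - j + 1) * 'C(2 * q + t - m, m - j)%:R
      * x q t * x m (r - t)%N.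

(* G_{j,q,r} depends on r >= -1 only through r+1, so it is indexed here by the
   natural number r1 = r+1: G_{j,q,r} is [G_poly x j q r.+1] for r >= 0 and
   G_{j,q,-1} is [G_poly x j q 0]. *)
Definition G_poly (K : fieldType) (x : nat -> nat -> K) (j q r1 : nat) : K :=
  \sum_(j <= l < ((j + q - 1)./2).+1)
     (-1) ^+ l * 'C(q - l - 1, l - j)%:R * x l r1
  + \sum_(j <= l < ((j + q)./2).+1)
     (-1) ^+ l * 'C(q - l, l - j)%:R * x l r1
  - (-1) ^+ q * x q r1.

(* Main.v *)
Require Import Defs.
From mathcomp Require Import all_boot all_order all_algebra.
From mathcomp Require Import zify ring.
Set Implicit Arguments.
Unset Strict Implicit.
Unset Printing Implicit Defensive.
Import GRing.Theory.
Local Open Scope ring_scope.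

(** The deformed bracket [B] is the bracket of m_0(n) plus
    Phi = x0 Psi_(k,-1) + Psi; the odd case is x0 = 0.  Its Jacobi identity
    is the vanishing of the jacobiator
    J(u,v,w) = B(B(u,v),w) + B(B(v,w),u) + B(B(w,u),v).

    Everything rests on one antisymmetric table of signed binomials,
    [basic_coef j a b], which is (-1)^(j-a) C(b-j-1, j-a) for a < b, a <= j
    and 0 for j < a < b.
    On basis vectors Psi_(j,s) sends (e_a, e_b) to basic_coef j a b e_(a+b+s),
    and this remains true of Psi_(k,-1) with s = -1: since basic_coef k a b
    vanishes for a + b <= 2k, and e_(a+b-1) vanishes for a + b > 2k + 1, only
    a + b = 2k + 1 is left when n = 2k ([Psi_basic_basis],
    [Psi_minus1_basis]).  Pascal's rule makes the table satisfy
    c(a,b) = c(a+1,b) + c(a,b+1) ([basic_coef_derivation]), which is the cocycle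
    condition: J(e_1, u, v) = 0, so D = ad e_1 is a derivation of B.

    Then D is a derivation of J as well, and D e_a = e_(a+1) for a >= 2.  Hence
    J(e_a, e_b, e_(c+1)) = D J(e_a, e_b, e_c) - J(e_(a+1), e_b, e_c)
                           - J(e_a, e_(b+1), e_c),
    and induction on the gap c - b shows that J vanishes as soon as it vanishes
    on the triples (e_j, e_q, e_(q+1)) with 2 <= j < q ([jacobi_consecutive]).

    It remains to expand J(e_j, e_q, e_(q+1)) in the basis, degree by degree
    ([deformation_obstruction]).  In each component, the products of two
    coordinates of Psi give F_(j,q,r) ([obstruction_F]).  The products in which
    Psi_(k,-1) is applied first vanish, and those in which it is applied last
    contribute only to the component of e_(2k), where its coefficients are
    signs, and give G_(j,q,r) ([obstruction_inner0], [obstruction_outer0]). *)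

(** * Alternating bilinear maps and the basis of m_0(n) *)

Section AlternatingForms.
Variables (K : fieldType) (n : nat).
Local Notation V := 'rV[K]_n.

(** Skew-symmetry is recorded along with [B u u = 0] so that neither has to be
    derived from the other; linearity in the second variable follows. *)
Definition alternating (W : lmodType K) (B : V -> V -> W) : Prop :=
  (forall c u u' v, B (c *: u + u') v = c *: B u v + B u' v)
  /\ (forall u, B u u = 0) /\ (forall u v, B u v = - B v u).

Lemma alternating_sum (W : lmodType K) (I : Type) (r : seq I)
    (F : I -> V -> V -> W) :
  (forall i, alternating (F i)) ->
  alternating (fun u v => \sum_(i <- r) F i u v).
Proof.
move=> altF; split=> [c u u' v|]; last split=> [u|u v].
- rewrite scaler_sumr -big_split; apply: eq_bigr => i _.
  by rewrite (altF i).1.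
- by rewrite big1 // => i _; rewrite (altF i).2.1.
- by rewrite -sumrN; apply: eq_bigr => i _; rewrite -(altF i).2.2.
Qed.

Lemma alternatingZ (W : lmodType K) (c : K) (B : V -> V -> W) :
  alternating B -> alternating (fun u v => c *: B u v).
Proof.
move=> [lB [aB sB]]; split=> [d u u' v|]; last split=> [u|u v].
- by rewrite lB scalerDr !scalerA mulrC.
- by rewrite aB scaler0.
- by rewrite sB scalerN.
Qed.

Lemma alternatingD (W : lmodType K) (B B' : V -> V -> W) :
  alternating B -> alternating B' ->
  alternating (fun u v => B u v + B' u v).
Proof.
move=> [lB [aB sB]] [lB' [aB' sB']]; split=> [c u u' v|]; last split=> [u|u v].
- by rewrite lB lB' scalerDr addrACA.
- by rewrite aB aB' addr0.
- by rewrite sB sB' opprD.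
Qed.

Lemma alternating_tensor (f : V -> V -> K) (e : V) :
  @alternating K^o f -> alternating (fun u v => f u v *: e).
Proof.
move=> [lf [af sf]]; split=> [c u u' v|]; last split=> [u|u v].
- by rewrite lf scalerDl scalerA.
- by rewrite af scale0r.
- by rewrite sf scaleNr.
Qed.

Lemma dual_eP (c : K) (i : nat) (u u' : V) :
  dual_e i (c *: u + u') = c * dual_e i u + dual_e i u'.
Proof.
rewrite /dual_e mulr_sumr -big_split; apply: eq_bigr => a _.
by rewrite !mxE.
Qed.

Lemma alternating_wedge (a b : nat) : @alternating K^o (wedge (K := K) (n := n) a b).
Proof.
rewrite /wedge; split=> [c u u' v|]; last split=> [u|u v].
- by rewrite !dual_eP /GRing.scale /=; ring.
- by rewrite subrr.
- by rewrite opprB.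
Qed.

Lemma alternating_bracket : alternating (@m0_bracket K n).
Proof.
by apply: alternating_sum => i; apply/alternating_tensor/alternating_wedge.
Qed.

Lemma alternating_Psi_basic (j s : nat) : alternating (@Psi_basic K n j s).
Proof.
apply: alternating_sum => i; apply: alternating_tensor.
apply: alternating_sum => l.
by apply: (@alternatingZ K^o _ (wedge _ _)); apply: alternating_wedge.
Qed.

Lemma alternating_Psi_minus1 (k : nat) : alternating (@Psi_minus1 K n k).
Proof.
apply/alternating_tensor/alternating_sum => l.
by apply: (@alternatingZ K^o _ (wedge _ _)); apply: alternating_wedge.
Qed.

Lemma alternating_Psi_comb (x : nat -> nat -> K) :
  alternating (@Psi_comb K n x).
Proof.
apply: alternating_sum => s; apply: alternating_sum => j.
by apply: alternatingZ; apply: alternating_Psi_basic.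
Qed.

Lemma dual_basis (i a : nat) :
  (0 < a <= n)%N -> dual_e i (basis_e K n a) = (i == a)%:R.
Proof.
case: a => [//|a] /= lt_an; rewrite /dual_e.
have [->|neq_ia] := eqVneq i a.+1.
  rewrite (big_pred1 (Ordinal lt_an)) ?mxE ?eqxx // => b /=.
rewrite big1 // => b /eqP eq_bi; rewrite mxE eq_bi.
by rewrite (negPf neq_ia).
Qed.

Lemma basis_out (a : nat) : (n < a)%N -> basis_e K n a = 0.
Proof.
move=> lt_na; apply/rowP => b; rewrite !mxE.
by case: eqP => // eq_ba; have := ltn_ord b; lia.
Qed.

Lemma row_basis (u : V) : u = \sum_(i < n) u 0 i *: basis_e K n i.+1.
Proof.
apply/rowP => i; rewrite summxE (bigD1 i) //= big1 => [|b neq_bi].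
  by rewrite !mxE eqxx mulr1 addr0.
by rewrite !mxE eqSS eq_sym (negPf (neq_bi : (b : nat) != i)) mulr0.
Qed.

End AlternatingForms.

(** * The jacobiator of a bracket for which ad e_1 is a derivation *)

Section Jacobiator.
Variables (K : fieldType) (n : nat) (B : cochain2 K n).
Local Notation V := 'rV[K]_n.
Local Notation e := (basis_e K n).
Hypothesis altB : alternating B.

Definition jacobiator (u v w : V) : V := B (B u v) w + B (B v w) u + B (B w u) v.

Lemma brC u v : B u v = - B v u. Proof. exact: altB.2.2. Qed.
Lemma br_lin c u u' v : B (c *: u + u') v = c *: B u v + B u' v.
Proof. exact: altB.1. Qed.
Lemma brDl u u' v : B (u + u') v = B u v + B u' v.
Proof. by have := br_lin 1 u u' v; rewrite !scale1r. Qed.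
Lemma br0l v : B 0 v = 0.
Proof. by have := brDl 0 0 v; rewrite addr0 -[X in X = _]addr0 => /addrI. Qed.
Lemma brZl c u v : B (c *: u) v = c *: B u v.
Proof. by have := br_lin c u 0 v; rewrite br0l !addr0. Qed.
Lemma brNl u v : B (- u) v = - B u v.
Proof. by rewrite -scaleN1r brZl scaleN1r. Qed.
Lemma brDr u v v' : B u (v + v') = B u v + B u v'.
Proof. by rewrite brC brDl opprD -!brC. Qed.
Lemma brZr c u v : B u (c *: v) = c *: B u v.
Proof. by rewrite brC brZl -scalerN -brC. Qed.
Lemma br_suml (I : Type) (r : seq I) (F : I -> V) v :
  B (\sum_(i <- r) F i) v = \sum_(i <- r) B (F i) v.
Proof. by apply: (big_morph (B^~ v)) => [u u'|]; rewrite ?brDl ?br0l. Qed.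

Lemma jacobiator_cycle u v w : jacobiator u v w = jacobiator v w u.
Proof. by rewrite /jacobiator -addrA addrC. Qed.

Lemma jacobiator_swap u v w : jacobiator u v w = - jacobiator v u w.
Proof.
rewrite /jacobiator (brC v u) (brC u w) (brC w v) !brNl.
by rewrite !opprD !opprK -addrA [X in _ + X]addrC addrA.
Qed.

Lemma jacobiator_diag u w : jacobiator u u w = 0.
Proof. by rewrite /jacobiator altB.2.1 br0l add0r (brC w u) brNl subrr. Qed.

Lemma jacobiator_lin c u u' v w :
  jacobiator (c *: u + u') v w = c *: jacobiator u v w + jacobiator u' v w.
Proof.
rewrite /jacobiator br_lin !brDr !brZr !brDl !brZl.
rewrite !scalerDr !addrA; apply/rowP=> i; rewrite !mxE; ring.
Qed.

(** The jacobiator is cyclically invariant, so linearity in its first variable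
    is enough to reduce any variable to basis vectors. *)
Lemma jacobiator_basis_l v w :
  (forall a, (0 < a)%N -> jacobiator (e a) v w = 0) ->
  forall u, jacobiator u v w = 0.
Proof.
move=> J0 u; rewrite [u]row_basis.
elim/big_rec: _ => [|i u' _ IH].
  by rewrite /jacobiator br0l (brC w 0) (brC v) br0l !oppr0 ?br0l (brC _ 0) br0l oppr0 !addr0.
by rewrite jacobiator_lin J0 // scaler0 add0r.
Qed.

Lemma jacobi_basis :
  (forall a b c, (0 < a)%N -> (0 < b)%N -> (0 < c)%N ->
     jacobiator (e a) (e b) (e c) = 0) -> jacobi B.
Proof.
move=> J0 u v w; rewrite -/(jacobiator u v w).
apply: jacobiator_basis_l => a a0 {u}.
rewrite jacobiator_cycle; apply: jacobiator_basis_l => b b0 {v}.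
rewrite jacobiator_cycle; apply: jacobiator_basis_l => c c0 {w}.
exact: J0.
Qed.

Lemma jacobi_sorted :
  (forall a b c, (0 < a < b)%N -> (b < c)%N ->
     jacobiator (e a) (e b) (e c) = 0) -> jacobi B.
Proof.
move=> J0; apply: jacobi_basis.
have J1 a b c : (0 < a)%N -> (0 < b)%N -> (0 < c)%N -> (a <= b)%N ->
    jacobiator (e a) (e b) (e c) = 0.
  move=> a0 b0 c0; rewrite leq_eqVlt => /predU1P[->|lt_ab].
    exact: jacobiator_diag.
  have [lt_bc|lt_cb|<-] := ltngtP b c; first by rewrite J0 ?a0.
    have [lt_ac|lt_ca|<-] := ltngtP a c.
    - by rewrite jacobiator_cycle jacobiator_swap jacobiator_cycle jacobiator_cycle
        J0 ?a0 ?oppr0.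
    - by rewrite -jacobiator_cycle J0 ?c0.
    - by rewrite -jacobiator_cycle jacobiator_diag.
  by rewrite jacobiator_cycle jacobiator_diag.
move=> a b c a0 b0 c0; have [|/ltnW] := leqP a b; first exact: J1.
by move=> le_ba; rewrite jacobiator_swap J1 ?oppr0.
Qed.

Hypothesis ad_e1E : forall b, (1 < b)%N -> B (e 1) (e b) = e b.+1.
Hypothesis J_e1E : forall a b, (1 < a)%N -> (1 < b)%N ->
  jacobiator (e 1) (e a) (e b) = 0.

Lemma jacobiator_e1 u v : jacobiator (e 1) u v = 0.
Proof.
rewrite jacobiator_cycle; move: u; apply: jacobiator_basis_l => a a0.
rewrite jacobiator_cycle; move: v; apply: jacobiator_basis_l => b b0.
rewrite jacobiator_cycle.
have [a1|] := leqP 2 a; last first.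
  by move=> ?; rewrite (_ : a = 1%N) ?jacobiator_diag //; lia.
have [b1|] := leqP 2 b; first exact: J_e1E.
by move=> ?; rewrite -jacobiator_cycle (_ : b = 1%N) ?jacobiator_diag //; lia.
Qed.

(** Read as an identity in [u] and [v], the Jacobi identity for triples that
    contain e_1 is the Leibniz rule for ad e_1. *)
Lemma ad_e1_derivation u v :
  B (e 1) (B u v) = B (B (e 1) u) v + B u (B (e 1) v).
Proof.
have := jacobiator_e1 u v; rewrite /jacobiator.
rewrite (brC (B u v)) (brC v) brNl -(brC u) addrAC.
by move/subr0_eq ->.
Qed.

(** The jacobiator is built from [B] by composition, so it inherits every
    derivation of [B]. *)
Lemma ad_e1_jacobiator u v w :
  B (e 1) (jacobiator u v w) = jacobiator (B (e 1) u) v w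
    + jacobiator u (B (e 1) v) w + jacobiator u v (B (e 1) w).
Proof.
rewrite /jacobiator !brDr !ad_e1_derivation !brDl.
by apply/rowP=> i; rewrite !mxE; ring.
Qed.

(** Applying ad e_1 to J(e_a, e_b, e_c) = 0 expresses J(e_a, e_b, e_(c+1))
    through jacobiators in which the two larger indices are closer.
    Gap 1 is the hypothesis, and when two indices coincide the jacobiator
    vanishes by skew-symmetry. *)
Lemma jacobi_consecutive :
  jacobi B <-> (forall j q, (1 < j < q)%N ->
     jacobiator (e j) (e q) (e q.+1) = 0).
Proof.
split=> [JB j q _|J0]; first exact: JB.
have gap d : forall a b, (1 < a < b)%N ->
    jacobiator (e a) (e b) (e (b + d).+1) = 0.
  elim/ltn_ind: d => -[|d] IH a b lt_ab; first by rewrite addn0 J0.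
  have a1 : (1 < a)%N by lia.
  have := ad_e1_jacobiator (e a) (e b) (e (b + d).+1).
  rewrite IH // !ad_e1E ?addnS; try lia.
  rewrite (brC _ 0) br0l oppr0.
  have -> : jacobiator (e a.+1) (e b) (e (b + d).+1) = 0.
    have [->|neq] := eqVneq a.+1 b; first exact: jacobiator_diag.
    by rewrite IH //; lia.
  have -> : jacobiator (e a) (e b.+1) (e (b + d).+1) = 0.
    case: d IH => [|d] IH.
      by rewrite addn0 jacobiator_cycle jacobiator_diag.
    by rewrite addnS -addSn IH //; lia.
  by rewrite !add0r.
apply: jacobi_sorted => a b c /andP[a0 lt_ab] lt_bc.
have [a1|] := leqP 2 a; last first.
  move=> ?; have -> : a = 1%N by lia.
  exact: jacobiator_e1.
have -> : c = (b + (c - b.+1)).+1 by lia.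
by apply: gap; rewrite a1.
Qed.

End Jacobiator.

(** * Coefficients of the basic cocycles *)

Section Coefficients.
Variable K : fieldType.

(** In Psi_(j,s) the pair a < b is reached from the summation indices
    l = j - a and i = a + b - 2j - 1, so that i + l = b - j - 1. *)
Definition sorted_coef (j a b : nat) : K :=
  if (a <= j)%N then (-1) ^+ (j - a) * 'C(b - j - 1, j - a)%:R else 0.

Definition basic_coef (j a b : nat) : K :=
  if (a < b)%N then sorted_coef j a b
  else if (b < a)%N then - sorted_coef j b a else 0.

Lemma basic_coef_lt j a b : (a < b)%N -> basic_coef j a b = sorted_coef j a b.
Proof. by rewrite /basic_coef => ->. Qed.

Lemma basic_coefC j a b : basic_coef j a b = - basic_coef j b a.
Proof. by rewrite /basic_coef; case: ltngtP; rewrite ?opprK ?oppr0. Qed.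

Lemma basic_coef_diag j a : basic_coef j a a = 0.
Proof. by rewrite /basic_coef ltnn. Qed.

(** Pascal's rule for a + 1 < b and a < j < b.  Elsewhere only boundary
    values of the table occur, and where a subtraction truncates, for j >= b,
    the lower entry of the binomial is positive, so the binomial is 0. *)
Lemma basic_coef_derivation j a b :
  basic_coef j a b = basic_coef j a.+1 b + basic_coef j a b.+1.
Proof.
wlog le_ab : a b / (a <= b)%N.
  move=> IH; have [/IH //|/ltnW/IH eq_ba] := leqP a b.
  by rewrite basic_coefC eq_ba opprD -!basic_coefC addrC.
have [->|neq_ab] := eqVneq a b.
  by rewrite [X in _ + X]basic_coefC subrr basic_coef_diag.
have lt_ab : (a < b)%N by rewrite ltn_neqAle neq_ab.
rewrite (basic_coef_lt _ lt_ab) (@basic_coef_lt _ a b.+1) 1?ltnW //.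
have [->|neq_aSb] := eqVneq b a.+1.
  rewrite basic_coef_diag add0r /sorted_coef; case: leqP => // le_aj.
  have [->|neq_aj] := eqVneq a j; first by rewrite subnn !bin0.
  by congr (_ * _%:R); rewrite !bin_small //; lia.
rewrite basic_coef_lt; last by lia.
rewrite /sorted_coef; have [lt_ja|le_aj] := ltnP j a.
  by rewrite ifF ?addr0 //; lia.
have [->|neq_aj] := eqVneq a j; first by rewrite ltnn subnn !bin0 add0r.
rewrite ifT; last by lia.
have -> : (j - a = (j - a.+1).+1)%N by lia.
have [le_bj|lt_jb] := leqP b j.
  by rewrite !bin_small ?mulr0 ?addr0 //; lia.
have -> : (b.+1 - j - 1 = (b - j - 1).+1)%N by lia.
by rewrite binS natrD exprS; ring.
Qed.

(** Here j - a > b - j - 1, so the binomial vanishes.  These zeros are what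
    lets the degree s = -1 fit the same pattern as s >= 0. *)
Lemma basic_coef_small j a b : (a + b <= 2 * j)%N -> basic_coef j a b = 0.
Proof.
wlog le_ab : a b / (a <= b)%N.
  move=> IH le_abj; have [le_ab|/ltnW le_ba] := leqP a b; first exact: IH.
  by rewrite basic_coefC IH ?oppr0 // addnC.
move=> le_abj; have [->|neq_ab] := eqVneq a b; first exact: basic_coef_diag.
rewrite basic_coef_lt ?ltn_neqAle ?neq_ab // /sorted_coef.
by case: leqP => // le_aj; rewrite bin_small ?mulr0 //; lia.
Qed.

Lemma basic_coef_top j a b :
  (a < b)%N -> (a + b = 2 * j + 1)%N -> basic_coef j a b = (-1) ^+ (j - a).
Proof.
move=> lt_ab eq_abj; rewrite basic_coef_lt // /sorted_coef ifT; last by lia.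
have -> : (b - j - 1 = j - a)%N by lia.
by rewrite binn mulr1.
Qed.

Variable n : nat.
Local Notation e := (basis_e K n).

Lemma wedge_basis p q a b : (0 < a <= n)%N -> (0 < b <= n)%N ->
  wedge p q (e a) (e b)
  = (p == a)%:R * (q == b)%:R - (p == b)%:R * (q == a)%:R.
Proof. by move=> ha hb; rewrite /wedge !dual_basis. Qed.

Lemma wedge_lt_basis p q a b : (p < q)%N -> (0 < a < b)%N -> (b <= n)%N ->
  wedge p q (e a) (e b) = ((p == a) && (q == b))%:R.
Proof.
move=> lt_pq lt_ab le_bn; rewrite wedge_basis; try lia.
by do 4 case: eqP => /=; rewrite ?mulr0 ?mul0r ?mul1r ?subr0 //; lia.
Qed.

Lemma alternating_out (B : cochain2 K n) a b : alternating B ->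
  (n < a)%N || (n < b)%N -> B (e a) (e b) = 0.
Proof.
move=> altB /orP[lt_n|lt_n]; rewrite (basis_out K lt_n).
  exact: (br0l altB).
by rewrite (brC altB) (br0l altB) oppr0.
Qed.

(** Evaluation on the basis, reduced to increasing pairs inside the range.  If
    an index exceeds [n], then the basis vector is zero on the left, and on the
    right [a + b >= n + 3] because the other index is at least 2; the bound
    [n + 2] leaves room for [d i = e_(i-1)], the case of degree -1. *)
Lemma alternating_lt_basis (B : cochain2 K n) (c : nat -> nat -> K)
    (d : nat -> 'rV[K]_n) :
  alternating B -> (forall a b, c a b = - c b a) -> (forall a, c a a = 0) ->
  (forall i, (n.+2 < i)%N -> d i = 0) ->
  (forall a b, (1 < a < b)%N -> (b <= n)%N -> B (e a) (e b) = c a b *: d (a + b)%N) ->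
  forall a b, (1 < a)%N -> (1 < b)%N -> B (e a) (e b) = c a b *: d (a + b)%N.
Proof.
move=> altB cC c0 d0 Hlt a b a1 b1.
have [le_n|out] := boolP ((a <= n) && (b <= n))%N; last first.
  rewrite d0 ?scaler0; last by lia.
  by apply: alternating_out => //; lia.
case: (ltngtP a b) => [lt_ab|lt_ba|->].
- by rewrite Hlt //; lia.
- by rewrite (brC altB) cC scaleNr addnC Hlt //; lia.
- by rewrite c0 scale0r altB.2.1.
Qed.

Lemma Psi_basic_basis j s a b : (1 < j)%N -> (1 < a)%N -> (1 < b)%N ->
  Psi_basic j s (e a) (e b) = basic_coef j a b *: e (a + b + s).
Proof.
move=> j1; move: a b.
apply: (alternating_lt_basis (d := fun i => e (i + s))).
- exact: alternating_Psi_basic.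
- exact: basic_coefC.
- exact: basic_coef_diag.
- by move=> i lt_ni; apply: basis_out; lia.
move=> a b /andP[a1 lt_ab] le_bn; rewrite basic_coef_lt //.
have wE p q : (p < q)%N ->
    wedge p q (e a) (e b) = ((p == a) && (q == b))%:R.
  by move=> lt_pq; apply: wedge_lt_basis; lia.
rewrite /Psi_basic.
have [/and3P[le_aj le_j le_n]|out] :=
    boolP [&& a <= j, 2 * j + 1 <= a + b & a + b + s <= n]%N.
  have lt_i : (a + b - (2 * j + 1) < n - (2 * j + s))%N by lia.
  have lt_l : (j - a < j - 1)%N by lia.
  rewrite (bigD1 (Ordinal lt_i)) //= [X in _ + X]big1 => [|i neq_i].
    rewrite addr0 (bigD1 (Ordinal lt_l)) //= [X in _ + X]big1 => [|l neq_l].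
      rewrite addr0 wE; last by lia.
      rewrite /sorted_coef le_aj.
      have -> : ((j - (j - a) == a) && (j + 1 + (j - a) + (a + b - (2 * j + 1)) == b))%N
        by lia.
      rewrite mulr1; congr (_ * _%:R *: e _); last by lia.
      by congr 'C(_, _); lia.
    have {}neq_l : (l != j - a :> nat)%N by [].
    rewrite wE; last by lia.
    by case: andP => [[/eqP ? /eqP ?]|]; [lia|rewrite mulr0].
  have {}neq_i : (i != a + b - (2 * j + 1) :> nat)%N by [].
  rewrite big1 ?scale0r // => l _; rewrite wE; last by lia.
  have := ltn_ord l.
  by case: andP => [[/eqP ? /eqP ?]|]; [lia|rewrite mulr0].
rewrite big1 => [|i _].
  have [le_n|?] := leqP (a + b + s)%N n; last by rewrite basis_out ?scaler0 //; lia.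
  rewrite /sorted_coef; case: ifP => [le_aj|_]; last by rewrite scale0r.
  by rewrite bin_small ?mulr0 ?scale0r //; lia.
rewrite big1 ?scale0r // => l _; rewrite wE; last by lia.
have := ltn_ord l; have := ltn_ord i.
by case: andP => [[/eqP ? /eqP ?]|]; [lia|rewrite mulr0].
Qed.

Lemma Psi_minus1_basis k a b : n = (2 * k)%N -> (1 < a)%N -> (1 < b)%N ->
  Psi_minus1 k (e a) (e b) = basic_coef k a b *: e (a + b).-1.
Proof.
move=> eq_n; move: a b.
apply: (alternating_lt_basis (d := fun i => e i.-1)).
- exact: alternating_Psi_minus1.
- exact: basic_coefC.
- exact: basic_coef_diag.
- by move=> i lt_ni; apply: basis_out; lia.
move=> a b /andP[a1 lt_ab] le_bn.
have wE p q : (p < q)%N ->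
    wedge p q (e a) (e b) = ((p == a) && (q == b))%:R.
  by move=> lt_pq; apply: wedge_lt_basis; lia.
rewrite /Psi_minus1; have [le_ab|gt_ab|eq_ab] := ltngtP (a + b)%N (2 * k + 1)%N.
- rewrite basic_coef_small ?scale0r; last by lia.
  rewrite big1 ?scale0r // => l _; rewrite wE; last by lia.
  have := ltn_ord l.
  by case: andP => [[/eqP ? /eqP ?]|]; [lia|rewrite mulr0].
- rewrite (@basis_out K n (a + b).-1) ?scaler0; last by lia.
  rewrite big1 ?scale0r // => l _; rewrite wE; last by lia.
  have := ltn_ord l.
  by case: andP => [[/eqP ? /eqP ?]|]; [lia|rewrite mulr0].
rewrite basic_coef_top //.
have lt_l : (k - a < k - 1)%N by lia.
rewrite (bigD1 (Ordinal lt_l)) //= big1 => [|l neq_l].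
  rewrite addr0 wE; last by lia.
  have -> : ((k - (k - a) == a) && (k + 1 + (k - a) == b))%N by lia.
  by rewrite mulr1; congr (_ *: e _); lia.
have {}neq_l : (l != k - a :> nat)%N by [].
rewrite wE; last by lia.
by case: andP => [[/eqP ? /eqP ?]|]; [lia|rewrite mulr0].
Qed.

End Coefficients.

(** * Comparing homogeneous components *)

Section Coordinates.
Variables (K : fieldType) (n : nat).
Local Notation e := (basis_e K n).

Lemma dual_e0 i : dual_e i (0 : 'rV[K]_n) = 0.
Proof. by rewrite /dual_e big1 // => a _; rewrite mxE. Qed.

Lemma dual_e_sum i (I : Type) (r : seq I) (c : I -> K) (v : I -> 'rV[K]_n) :
  dual_e i (\sum_(h <- r) c h *: v h) = \sum_(h <- r) c h * dual_e i (v h).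
Proof.
elim: r => [|h r IH]; first by rewrite !big_nil dual_e0.
by rewrite !big_cons dual_eP IH.
Qed.

Lemma dual_basis_le i a :
  (0 < a)%N -> (i <= n)%N -> dual_e i (e a) = (i == a)%:R.
Proof.
move=> a0 le_in; have [le_an|lt_na] := leqP a n; first by rewrite dual_basis ?a0.
rewrite basis_out // dual_e0; case: eqP => // eq_ia; lia.
Qed.

Lemma sum_delta (N i : nat) (c : nat -> K) :
  (i < N)%N -> \sum_(0 <= h < N) c h * (i == h)%:R = c i.
Proof.
move=> lt_iN; rewrite big_mkord (bigD1 (Ordinal lt_iN)) //= eqxx mulr1.
rewrite big1 ?addr0 // => h neq_h.
by rewrite eq_sym (negPf (neq_h : (h : nat) != i)) mulr0.
Qed.

(** A double sum indexed by two degrees vanishes exactly when each of its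
    components of total degree r does; the components with index beyond [n]
    impose no condition, as the basis vector is zero there. *)
Lemma graded_double_sum_eq0 (N d : nat) (A : nat -> nat -> K) :
  (1 < d)%N -> (forall r, ((d + r).-1 <= n)%N -> (r < N)%N) ->
  \sum_(0 <= t < N) \sum_(0 <= t' < N) A t t' *: e (d + t + t').-1 = 0 <->
  (forall r, ((d + r).-1 <= n)%N -> \sum_(0 <= t < r.+1) A t (r - t)%N = 0).
Proof.
move=> d1 ltN; set v := \sum_(0 <= t < N) _.
have coord m : (m <= n)%N -> dual_e m v =
    \sum_(0 <= t < N) \sum_(0 <= t' < N) A t t' * (m == (d + t + t').-1)%:R.
  move=> le_mn.
  have -> : v = \sum_(0 <= t < N) 1 *: \sum_(0 <= t' < N) A t t' *: e (d + t + t').-1.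
    by apply: eq_bigr => t _; rewrite scale1r.
  rewrite dual_e_sum; apply: eq_bigr => t _; rewrite mul1r dual_e_sum.
  by apply: eq_bigr => t' _; rewrite dual_basis_le //; lia.
have homog r : ((d + r).-1 <= n)%N ->
    dual_e (d + r).-1 v = \sum_(0 <= t < r.+1) A t (r - t)%N.
  move=> le_rn; have lt_rN := ltN _ le_rn; rewrite coord //.
  rewrite (big_cat_nat _ (n := r.+1)) //= [X in _ + X]big_nat_cond.
  rewrite [X in _ + X]big1 ?addr0 => [|t /andP[/andP[lt_rt _] _]].
    apply: eq_big_nat => t /andP[_ le_tr].
    rewrite -[RHS](@sum_delta N (r - t)%N (A t)); last by lia.
    by apply: eq_bigr => t' _; congr (_ * _%:R); lia.
  rewrite big1 // => t' _; case: eqP => [|_]; [lia|by rewrite mulr0].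
split=> [v0 r le_rn|A0]; first by rewrite -homog // v0 dual_e0.
apply/rowP => i; have ltin := ltn_ord i.
have -> : v 0 i = dual_e i.+1 v.
  by rewrite /dual_e (big_pred1 i) // => b; rewrite eqSS.
rewrite mxE; have [le_di|lt_id] := leqP d.-1 i.+1.
  (* The component of e_(i+1) has total degree i + 1 - (d - 1). *)
  have eq_i : i.+1 = (d + (i.+1 - d.-1)).-1 by lia.
  by rewrite eq_i homog ?A0 // -eq_i.
rewrite coord // big1 // => t _; rewrite big1 // => t' _.
by case: eqP => [|_]; [lia|rewrite mulr0].
Qed.

End Coordinates.

(** * The deformed bracket on the basis *)

Section Deformation.
Variables (K : fieldType) (n k : nat) (x0 : K) (x : nat -> nat -> K).
Hypothesis n5 : (5 <= n)%N.
Hypothesis x0_or_even : x0 = 0 \/ n = (2 * k)%N.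
Local Notation e := (basis_e K n).

(** Degrees are shifted by one: [deg_coef 0] belongs to x0 Psi_(k,-1), of degree
    -1, and [deg_coef s.+1] to the component of degree s of Psi.  The shift lets
    [Phi_basis] treat all degrees in a single sum, whose vectors are
    e_(a+b+t-1). *)
Definition deg_coef (t a b : nat) : K :=
  if t is s.+1 then \sum_(2 <= j < ((n - 1)./2).+1) x j s * basic_coef K j a b
  else x0 * basic_coef K k a b.

Definition Phi : cochain2 K n :=
  fun u v => x0 *: Psi_minus1 k u v + Psi_comb x u v.

Definition deformed_bracket : cochain2 K n :=
  fun u v => m0_bracket u v + Phi u v.

Local Notation Br := deformed_bracket.

Lemma deg_coefC t a b : deg_coef t a b = - deg_coef t b a.
Proof.
case: t => [|s] /=; first by rewrite basic_coefC mulrN.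
by rewrite -sumrN; apply: eq_bigr => j _; rewrite basic_coefC mulrN.
Qed.

Lemma deg_coef_derivation t a b :
  deg_coef t a b = deg_coef t a.+1 b + deg_coef t a b.+1.
Proof.
case: t => [|s] /=; first by rewrite basic_coef_derivation mulrDr.
by rewrite -big_split; apply: eq_bigr => j _; rewrite basic_coef_derivation mulrDr.
Qed.

Lemma alternating_deformed : alternating Br.
Proof.
apply: alternatingD; first exact: alternating_bracket.
apply: alternatingD; last exact: alternating_Psi_comb.
by apply: alternatingZ; apply: alternating_Psi_minus1.
Qed.

Local Notation altB := alternating_deformed.

Lemma Phi_basis a b : (1 < a)%N -> (1 < b)%N ->
  Phi (e a) (e b)
  = \sum_(0 <= t < (n - 5).+2) deg_coef t a b *: e (a + b + t).-1.
Proof.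
move=> a1 b1; rewrite big_nat_recl //= addn0; congr (_ + _).
  case: x0_or_even => [->|eq_n]; first by rewrite mul0r !scale0r.
  by rewrite Psi_minus1_basis // scalerA.
apply: eq_bigr => s _; rewrite addnS scaler_suml.
apply: eq_big_nat => j /andP[j1 _].
by rewrite Psi_basic_basis // scalerA.
Qed.

Lemma bracket_basis a b : (1 < a)%N -> (1 < b)%N -> m0_bracket (e a) (e b) = 0.
Proof.
move=> a1 b1; rewrite /m0_bracket big1 // => i _.
have dual1 c : (1 < c)%N -> dual_e 1 (e c) = 0.
  move=> c1; rewrite dual_basis_le //; try lia.
  by case: eqP => [|//]; lia.
by rewrite /wedge !dual1 // !mul0r subrr scale0r.
Qed.

Lemma deformed_basis a b : (1 < a)%N -> (1 < b)%N ->
  Br (e a) (e b)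
  = \sum_(0 <= t < (n - 5).+2) deg_coef t a b *: e (a + b + t).-1.
Proof. by move=> a1 b1; rewrite /Br bracket_basis // add0r Phi_basis. Qed.

Lemma wedge_e1 p q v : (1 < p)%N -> (1 < q)%N -> wedge p q (e 1) v = 0.
Proof.
move=> p1 q1; rewrite /wedge !dual_basis; try lia.
have -> : (p == 1%N) = false by lia.
have -> : (q == 1%N) = false by lia.
by rewrite mul0r mulr0 subrr.
Qed.

Lemma Phi_e1 v : Phi (e 1) v = 0.
Proof.
rewrite /Phi /Psi_minus1 big1 ?scale0r ?scaler0 ?add0r => [|l _]; last first.
  by have := ltn_ord l => ?; rewrite wedge_e1 ?mulr0 //; lia.
rewrite /Psi_comb big1 // => s _; rewrite big1 // => j _.
rewrite /Psi_basic big1 ?scaler0 // => i _; rewrite big1 ?scale0r // => l _.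
by have := ltn_ord l => ?; rewrite wedge_e1 ?mulr0 //; lia.
Qed.

Lemma deformed_e1 b : (1 < b)%N -> Br (e 1) (e b) = e b.+1.
Proof.
move=> b1; rewrite /Br Phi_e1 addr0.
have [lt_nb|le_bn] := ltnP n b.
  rewrite (alternating_out (alternating_bracket K n)) ?lt_nb ?orbT //.
  by rewrite basis_out //; lia.
rewrite /m0_bracket (eq_big_nat _ _ (F2 := fun i => (b == i)%:R *: e i.+1)); last first.
  move=> i /andP[i1 lt_in]; rewrite wedge_lt_basis; try lia.
  by rewrite eqxx [i == b]eq_sym.
have [lt_bn|le_nb] := ltnP b n; last first.
  rewrite basis_out; last by lia.
  rewrite big_nat_cond big1 // => i /andP[/andP[_ lt_in] _].
  by case: eqP => [|_]; [lia|rewrite scale0r].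
rewrite (bigD1_seq b) ?mem_index_iota ?iota_uniq ?b1 //= eqxx scale1r.
rewrite big1 ?addr0 // => i neq_ib.
by rewrite eq_sym (negPf neq_ib) scale0r.
Qed.

(** The cocycle condition for Phi, degree by degree. *)
Lemma jacobiator_e1_basis a b : (1 < a)%N -> (1 < b)%N ->
  jacobiator Br (e 1) (e a) (e b) = 0.
Proof.
move=> a1 b1; rewrite /jacobiator.
rewrite (brC altB (e b)) !deformed_e1 // (brNl altB) (brC altB (e b.+1)) opprK.
rewrite !deformed_basis //; try lia.
rewrite (br_suml altB) -!big_split big_nat_cond big1 // => t _.
rewrite (brZl altB) (brC altB) deformed_e1; last by lia.
rewrite scalerN [deg_coef t a b]deg_coef_derivation.
have -> : (a + b + t).-1.+1 = (a + b + t)%N by lia.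
by rewrite addSn /= addnS addSn /= scalerDl opprD addrA subrr add0r addNr.
Qed.

(** The coefficient in B(B(e_a, e_b), e_c) that comes from the part of shifted
    degree [t] followed by the part of shifted degree [t']. *)
Definition jacobi_coef (a b c t t' : nat) : K :=
  deg_coef t a b * deg_coef t' (a + b + t).-1 c.

Lemma deformed_twice a b c : (1 < a)%N -> (1 < b)%N -> (1 < c)%N ->
  Br (Br (e a) (e b)) (e c) =
  \sum_(0 <= t < (n - 5).+2) \sum_(0 <= t' < (n - 5).+2)
    jacobi_coef a b c t t' *: e ((a + b + c).-1 + t + t').-1.
Proof.
move=> a1 b1 c1; rewrite deformed_basis // (br_suml altB).
apply: eq_bigr => t _; rewrite (brZl altB) deformed_basis //; last by lia.
rewrite scaler_sumr; apply: eq_bigr => t' _; rewrite scalerA.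
by congr (_ *: e _); lia.
Qed.

Definition obstruction (j q t t' : nat) : K :=
  jacobi_coef j q q.+1 t t' + jacobi_coef q q.+1 j t t' + jacobi_coef q.+1 j q t t'.

Lemma deformation_obstruction :
  deformation_equation Phi <->
  (forall j q, (1 < j < q)%N -> forall r, ((j + 2 * q + r).-1 <= n)%N ->
     \sum_(0 <= t < r.+1) obstruction j q t (r - t) = 0).
Proof.
rewrite /deformation_equation -/Br.
have Jobs j q : (1 < j < q)%N ->
  jacobiator Br (e j) (e q) (e q.+1) = 0 <->
  (forall r, ((j + 2 * q + r).-1 <= n)%N ->
     \sum_(0 <= t < r.+1) obstruction j q t (r - t) = 0).
  move=> jq.
  suff <- : \sum_(0 <= t < (n - 5).+2) \sum_(0 <= t' < (n - 5).+2)
      obstruction j q t t' *: e (j + 2 * q + t + t').-1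
      = jacobiator Br (e j) (e q) (e q.+1).
    by apply: graded_double_sum_eq0 => [|r]; lia.
  rewrite /jacobiator !deformed_twice; try lia.
  rewrite -!big_split; apply: eq_bigr => t _.
  rewrite -!big_split; apply: eq_bigr => t' _ /=.
  rewrite /obstruction !scalerDl.
  by congr (_ *: e _ + _ *: e _ + _ *: e _); lia.
have := jacobi_consecutive altB deformed_e1 jacobiator_e1_basis.
move=> ->; split=> H j q jq; [apply/(Jobs j q jq)|apply/(Jobs j q jq)]; exact: H.
Qed.

End Deformation.

(** * Identification of the quadratic equations *)

Section Obstructions.
Variables (K : fieldType) (n k : nat) (x0 : K) (x : nat -> nat -> K).
Hypothesis x0_or_even : x0 = 0 \/ n = (2 * k)%N.

Local Notation cf := (deg_coef n k x0 x).
Local Notation obs := (obstruction n k x0 x).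

(** The bound on [a + b] guarantees that the coordinates which can contribute,
    those with 2l < a + b, all occur in Psi, where l <= (n-1)/2. *)
Lemma deg_coefS s a b : (1 < a < b)%N -> (a + b <= n)%N ->
  cf s.+1 a b = \sum_(a <= l < ((a + b - 1)./2).+1)
                  (-1) ^+ (l - a) * 'C(b - l - 1, l - a)%:R * x l s.
Proof.
move=> /andP[a1 lt_ab] le_n /=.
rewrite (big_cat_nat _ (n := a)) //=; try lia.
rewrite big_nat_cond big1 ?add0r => [|j /andP[/andP[_ lt_ja] _]]; last first.
  by rewrite basic_coef_lt // /sorted_coef leqNgt lt_ja mulr0.
rewrite (big_cat_nat _ (n := ((a + b - 1)./2).+1)) //=; try lia.
rewrite [X in _ + X]big_nat_cond [X in _ + X]big1 ?addr0.
  apply: eq_big_nat => l /andP[le_al _].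
  by rewrite basic_coef_lt // /sorted_coef le_al mulrC.
move=> j /andP[/andP[lt_j _] _].
by rewrite basic_coef_small ?mulr0 //; lia.
Qed.

Lemma deg_coef0_small a b : (a + b <= n)%N -> cf 0 a b = 0.
Proof.
case: x0_or_even => [->|eq_n] le_n /=; first by rewrite mul0r.
by rewrite basic_coef_small ?mulr0 //; lia.
Qed.

Lemma deg_coef_consecutive s q : (1 < q)%N -> (2 * q < n)%N ->
  cf s.+1 q q.+1 = x q s.
Proof.
move=> q1 le_n; rewrite deg_coefS; try lia.
have -> : ((q + q.+1 - 1)./2).+1 = q.+1 by lia.
by rewrite big_nat1 subnn bin0 !mul1r.
Qed.

(** Psi_(k,-1) is nonzero only on indices whose sum is 2k + 1.  As the inner
    map, it would force the index of the result above 2k. *)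
Lemma obstruction_inner0 j q r : (1 < j < q)%N ->
  ((j + 2 * q + r).-1 <= n)%N -> obs j q 0 r = 0.
Proof.
move=> jq le_n; rewrite /obstruction /jacobi_coef !deg_coef0_small; try lia.
by rewrite !mul0r !addr0.
Qed.

(** When Psi_(k,-1) is applied last, the sum of the two indices it receives is
    one more than the index of the result.  It is nonzero only if this sum is
    2k + 1, and then [basic_coef_top] makes its coefficient a sign. *)
Lemma obstruction_outer0 j q t : (1 < j < q)%N -> (j + 2 * q + t <= n)%N ->
  obs j q t.+1 0 = if (j + 2 * q + t == n)%N
    then (-1) ^+ (k + j + q) * x0 * G_poly x j q t else 0.
Proof.
move=> jq le_n; rewrite /obstruction /jacobi_coef; case: eqP => [eq_n|neq_n]; last first.
  by rewrite ![cf 0 _ _]deg_coef0_small ?mulr0 ?addr0 //; lia.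
case: x0_or_even => [x00|eq_2k].
  by rewrite /= x00 !mul0r !mulr0 !mul0r !addr0.
have top a b : (a < b)%N -> (a + b = n.+1)%N -> cf 0 a b = (-1) ^+ (k + a) * x0.
  move=> lt_ab eq_ab; rewrite /= basic_coef_top; try lia.
  have le_ak : (a <= k)%N by lia.
  by rewrite mulrC -signr_odd oddB // -oddD signr_odd.
rewrite (deg_coefC _ _ _ _ 0 (j + q + t.+1).-1) top; try lia.
rewrite (deg_coefC _ _ _ _ 0 (q + q.+1 + t.+1).-1) top; try lia.
rewrite (deg_coefC _ _ _ _ 0 (q.+1 + j + t.+1).-1) top; try lia.
rewrite deg_coef_consecutive; try lia.
rewrite (deg_coefC _ _ _ _ t.+1 q.+1) !deg_coefS; try lia.
rewrite /G_poly.
have -> : \sum_(j <= l < ((j + q - 1)./2).+1)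
     (-1) ^+ l * 'C(q - l - 1, l - j)%:R * x l t
  = (-1) ^+ j * \sum_(j <= l < ((j + q - 1)./2).+1)
     (-1) ^+ (l - j) * 'C(q - l - 1, l - j)%:R * x l t.
  rewrite mulr_sumr; apply: eq_big_nat => l /andP[le_jl _].
  by rewrite !mulrA -exprD subnKC.
have -> : \sum_(j <= l < ((j + q)./2).+1)
     (-1) ^+ l * 'C(q - l, l - j)%:R * x l t
  = (-1) ^+ j * \sum_(j <= l < ((j + q.+1 - 1)./2).+1)
     (-1) ^+ (l - j) * 'C(q.+1 - l - 1, l - j)%:R * x l t.
  rewrite mulr_sumr addnS subn1 /=; apply: eq_big_nat => l /andP[le_jl lt_l].
  rewrite !mulrA -exprD subnKC //.
  by have -> : (q.+1 - l - 1 = q - l)%N by lia.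
set S1 := \sum_(_ <= _ < _) _; set S2 := \sum_(_ <= _ < _) _.
have -> : (-1) ^+ (k + q.+1) = - (-1) ^+ (k + q) :> K by rewrite addnS exprS mulN1r.
rewrite -addnA (exprD _ k (j + q)) (exprD _ j q) (exprD _ k q) (exprD _ k j).
have sq a : (-1) ^+ a * (-1) ^+ a = 1 :> K by rewrite -exprD addnn -signr_odd odd_double.
have := sq j; have := sq q.
move: ((-1) ^+ j) ((-1) ^+ q) ((-1) ^+ k) => sj sq' sk Hq Hj.
(* Every term contains the square of the sign of j or of the sign of q. *)
have -> : sk * (sj * sq') * x0 * (sj * S1 + sj * S2 - sq' * x q t)
  = sk * x0 * ((sj * sj) * sq' * S1 + (sj * sj) * sq' * S2 - (sq' * sq') * sj * x q t).
  by ring.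
rewrite Hq Hj; ring.
Qed.

(** The three sums of [F_poly] are the three cyclic terms of the jacobiator on
    (e_j, e_q, e_(q+1)), in the order in which the inner pair is (j, q), then
    (q+1, j), then (q, q+1). *)
Lemma obstruction_F j q r : (1 < j < q)%N -> (j + 2 * q + 1 + r <= n)%N ->
  \sum_(0 <= t < r.+1) obs j q t.+1 (r - t).+1 = F_poly x j q r.
Proof.
move=> jq le_n; rewrite /F_poly -!big_split.
apply: eq_big_nat => t /andP[_ lt_tr] /=.
rewrite /obstruction /jacobi_coef [LHS]addrAC; congr (_ + _ + _).
- have -> : (j + q + t.+1).-1 = (j + q + t)%N by lia.
  rewrite (deg_coefC _ _ _ _ _ (j + q + t)) !deg_coefS; try lia.
  rewrite mulr_suml; apply: eq_big_nat => l /andP[le_jl lt_l].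
  have -> : ((q.+1 + (j + q + t) - 1)./2 = q + (j + t)./2)%N by lia.
  rewrite addn1 -sumrN mulr_sumr; apply: eq_big_nat => m /andP[lt_qm lt_m].
  have -> : (m - q = (m - q.+1).+1)%N by lia.
  have -> : ((m - q.+1).+1 - 1 = m - q.+1)%N by lia.
  by rewrite exprD exprS; ring.
- have -> : (q.+1 + j + t.+1).-1 = (j + q + 1 + t)%N by lia.
  rewrite (deg_coefC _ _ _ _ _ q.+1) (deg_coefC _ _ _ _ _ (j + q + 1 + t)) mulrNN.
  rewrite !deg_coefS; try lia.
  have -> : ((j + q.+1 - 1)./2 = (j + q)./2)%N by lia.
  rewrite mulr_suml; apply: eq_big_nat => l /andP[le_jl lt_l].
  have -> : ((q + (j + q + 1 + t) - 1)./2 = q + (j + t)./2)%N by lia.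
  rewrite mulr_sumr; apply: eq_big_nat => m /andP[lt_qm lt_m].
  have -> : (q.+1 - l - 1 = q - l)%N by lia.
  have -> : (j + q + 1 + t - m - 1 = j + q + t - m)%N by lia.
  by rewrite exprD; ring.
rewrite deg_coef_consecutive; try lia.
have -> : (q + q.+1 + t.+1).-1 = (2 * q + 1 + t)%N by lia.
rewrite (deg_coefC _ _ _ _ _ (2 * q + 1 + t)) deg_coefS; try lia.
have -> : ((j + (2 * q + 1 + t) - 1)./2 = q + (j + t)./2)%N by lia.
rewrite -sumrN mulr_sumr; apply: eq_big_nat => m /andP[lt_qm lt_m].
have -> : (2 * q + 1 + t - m - 1 = 2 * q + t - m)%N by lia.
by rewrite addn1 exprS; ring.
Qed.

(** The shifted total degrees 0, 1 and r + 2 give respectively nothing, the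
    condition on G_(j,q,-1) alone, and the equation that starts with
    F_(j,q,r). *)
Lemma deformation_system : (5 <= n)%N ->
  deformation_equation (@Phi K n k x0 x) <->
  [/\ forall j q, (1 < j < q)%N -> (j + 2 * q = n)%N -> x0 * G_poly x j q 0 = 0
    & forall j q r, (1 < j < q)%N -> (j + 2 * q + 1 + r <= n)%N ->
      F_poly x j q r + (if (j + 2 * q + 1 + r == n)%N
        then (-1) ^+ (k + j + q) * x0 * G_poly x j q r.+1 else 0) = 0].
Proof.
move=> n5; have low j q : (1 < j < q)%N -> (j + 2 * q <= n)%N ->
    \sum_(0 <= t < 2) obs j q t (1 - t) = if (j + 2 * q == n)%N
      then (-1) ^+ (k + j + q) * x0 * G_poly x j q 0 else 0.
  move=> jq le_n; rewrite big_nat_recl // big_nat1 subnn.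
  rewrite obstruction_inner0 ?add0r //; last by lia.
  by have := @obstruction_outer0 j q 0 jq; rewrite addn0; apply.
have high j q r : (1 < j < q)%N -> (j + 2 * q + 1 + r <= n)%N ->
    \sum_(0 <= t < r.+3) obs j q t (r.+2 - t) =
    F_poly x j q r + (if (j + 2 * q + 1 + r == n)%N
      then (-1) ^+ (k + j + q) * x0 * G_poly x j q r.+1 else 0).
  move=> jq le_n; rewrite big_nat_recl // big_nat_recr //=.
  rewrite obstruction_inner0 ?add0r //; last by lia.
  rewrite subSS subnn obstruction_outer0 //; last by lia.
  rewrite -(obstruction_F jq le_n) addnS addn1 addSn.
  congr (_ + _); apply: eq_big_nat => t /andP[_ lt_tr].
  by congr obstruction; lia.
rewrite deformation_obstruction //; split=> [obs0|[G0 FG0] j q jq].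
  split=> [j q jq eq_n|j q r jq le_n]; last by rewrite -high // obs0 //; lia.
  have := low j q jq; rewrite eq_n eqxx obs0 //; last by lia.
  move=> /(_ (leqnn _)) /esym/eqP.
  by rewrite -mulrA mulf_eq0 signr_eq0 /= => /eqP.
case=> [|[|r]] le_n.
- by rewrite big_nat1 obstruction_inner0.
- rewrite low //; last by lia.
  by case: eqP => // eq_n; rewrite -mulrA G0 ?mulr0.
by rewrite high ?FG0 //; lia.
Qed.

End Obstructions.

Lemma eq_deformation (K : fieldType) (n : nat) (B B' : cochain2 K n) :
  (forall u v, B u v = B' u v) ->
  deformation_equation B -> deformation_equation B'.
Proof. by move=> eqB defB u v w; rewrite /= -!eqB; apply: defB. Qed.

Theorem theorem4p3 (K : fieldType) (charK0 : [pchar K] =i pred0) :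
  (forall (n k : nat) (x : nat -> nat -> K),
     n = (2 * k + 1)%N -> (9 <= n)%N ->
     deformation_equation (Psi_comb (n := n) x) <->
     (forall j q r : nat,
        (2 <= j)%N -> (j < q)%N -> (9 <= j + 2 * q + 1 + r <= n)%N ->
        F_poly x j q r = 0))
  /\
  (forall (n k : nat) (x0 : K) (x : nat -> nat -> K),
     n = (2 * k)%N -> (10 <= n)%N -> x0 = 0 \/ x0 = 1 ->
     deformation_equation
       (fun u v : 'rV[K]_n => x0 *: Psi_minus1 k u v + Psi_comb x u v) <->
     [/\ forall j q r : nat,
           (2 <= j)%N -> (j < q)%N -> (9 <= j + 2 * q + 1 + r < 2 * k)%N ->
           F_poly x j q r = 0,
         forall j q r : nat,
           (2 <= j)%N -> (j < q)%N -> (j + 2 * q + 1 + r = 2 * k)%N ->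
           F_poly x j q r
             + (-1) ^ (k%:Z - j%:Z - q%:Z) * x0 * G_poly x j q r.+1 = 0
       & forall j q : nat,
           (2 <= j)%N -> (j < q)%N -> (j + 2 * q = 2 * k)%N ->
           x0 * G_poly x j q 0 = 0]).
Proof.
split=> [n k x eq_n n9|n k x0 x eq_n n10 _].
  have PhiE u v : @Phi K n k 0 x u v = Psi_comb x u v by rewrite /Phi scale0r add0r.
  have sys := @deformation_system K n k 0 x (or_introl erefl) (leq_trans _ n9).
  split=> [defPsi j q r j2 lt_jq le_n|F0].
    have /sys[//|_ FG0] : deformation_equation (@Phi K n k 0 x).
      by apply: eq_deformation defPsi => u v; rewrite PhiE.
    have := FG0 j q r; rewrite mulr0 !mul0r if_same addr0; apply; lia.
  apply: (eq_deformation PhiE); apply/sys => //; split=> [j q _ _|j q r jq le_n].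
    by rewrite mul0r.
  by rewrite mulr0 !mul0r if_same addr0 F0 //; lia.
have sign j q : (-1) ^ (k%:Z - j%:Z - q%:Z) = (-1) ^+ (k + j + q) :> K.
  by rewrite !expfzDr ?oppr_eq0 ?oner_eq0 // -!invr_expz -!exprnP !invr_sign !exprD.
have := @deformation_system K n k x0 x (or_intror eq_n) (leq_trans _ n10).
rewrite /Phi => ->//; split=> [[G0 FG0]|[F0 FG0 G0]].
  split=> [j q r j2 lt_jq le_n|j q r j2 lt_jq eq_r|j q j2 lt_jq eq_jq].
  - have := FG0 j q r; rewrite ifF ?addr0; last by lia.
    by apply; lia.
  - by have := FG0 j q r; rewrite sign ifT; [apply; lia|lia].
  - by apply: G0; lia.
split=> [j q jq eq_jq|j q r jq le_n]; first by apply: G0; lia.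
case: eqP => [eq_r|neq_r]; last by rewrite F0 ?addr0 //; lia.
by rewrite -sign FG0 //; lia.
Qed.
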